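(* Let $\beta\in\mathbb{C}$ with $|\beta|>1$, and let $A\subset\mathbb{C}$ be a finite alphabet with $0\in A$. Then the numeration system $(\beta,A)$ allows preprocessing if and only if the spectrum $S_A(\beta)$ has no accumulation point (in $\mathbb{C}$).
   Context: For a finite word $x_1\cdots x_j$ of complex digits, $0.x_1x_2\cdots x_j$ denotes the number $\sum_{i=1}^j x_i\beta^{-i}$. The $A$-spectrum of $\beta$ is $S_A(\beta)=\{\sum_{k=0}^n a_k\beta^k \mid n\in\mathbb{N},\ a_k\in A\}$, where $\mathbb{N}=\{0,1,2,\dots\}$. A point $s\in\mathbb{C}$ is an accumulation point of a set $X\subset\mathbb{C}$ if every neighbourhood of $s$ contains infinitely many elements of $X$. The numeration system $(\beta,A)$ allows preprocessing if there exist a real number $D>0$ and a finite list $\mathcal{L}$ of (valid) identities of the type $0.w_kw_{k-1}\cdots w_0=0.0u_{k-1}\cdots u_0$ (where $k\ge 0$ may vary with the identity) with all digits $w_i,u_i$ in $A$, such that every infinite string $d_1d_2\cdots$ over $A$ that does not have as a prefix any of the left-hand words $w_k\cdots w_0$ from $\mathcal{L}$ satisfies $|0.d_1d_2\cdots d_j|>D$ for all integers $j\ge 1$. (Left-hand words beginning with the digit $0$ are permitted in $\mathcal{L}$.) *)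

(* Defs.v *)
From HB Require Import structures.
From mathcomp Require Import all_boot all_order all_algebra finmap.
From mathcomp Require Import complex.
From mathcomp Require Import all_classical all_reals all_analysis.

Set Implicit Arguments.
Unset Strict Implicit.
Unset Printing Implicit Defensive.

Import Order.TTheory GRing.Theory Num.Theory.
Import numFieldNormedType.Exports.

Local Open Scope classical_set_scope.
Local Open Scope ring_scope.
Local Open Scope complex_scope.

(* Unlike [limit_point], this asks for infinitely many points of X near s. *)
Definition accumulation_point (T : topologicalType) (X : set T) (s : T) : Prop :=
  forall U : set T, nbhs s U -> infinite_set (X `&` U).

Section Numeration.
Variable R : realType.
Implicit Types (beta : R[i]) (A : {fset R[i]}) (w u : seq R[i]).

(* 0.x_1 x_2 ... x_j in base beta, the digit x_i.+1 being the entry of index i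
   of the list. *)
Definition frac_value beta w : R[i] :=
  \sum_(i < size w) w`_i * beta ^- i.+1.

Definition spectrum beta A : set R[i] :=
  [set x | exists (n : nat) (a : nat -> R[i]),
     (forall k, (k <= n)%N -> a k \in A) /\
     x = \sum_(k < n.+1) a k * beta ^+ k].

(* The pair (w, u) stands for 0.w_k w_(k-1) ... w_0 = 0.0 u_(k-1) ... u_0, most
   significant digit first; thus u is one digit shorter than w. *)
Definition rewriting_identity beta A (wu : seq R[i] * seq R[i]) : Prop :=
  [/\ size wu.1 = (size wu.2).+1,
      {subset wu.1 <= A},
      {subset wu.2 <= A} &
      frac_value beta wu.1 = frac_value beta (0 :: wu.2)].

(* The infinite string d_1 d_2 ... is the function d with d i = d_(i+1), so that
   [mkseq d j] is its prefix d_1 ... d_j. *)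
Definition allows_preprocessing beta A : Prop :=
  exists (D : R) (L : seq (seq R[i] * seq R[i])),
    [/\ 0 < D,
        forall wu, wu \in L -> rewriting_identity beta A wu &
        forall d : nat -> R[i],
          (forall i, d i \in A) ->
          (forall n, mkseq d n \notin unzip1 L) ->
          forall j, (1 <= j)%N -> D%:C < `|frac_value beta (mkseq d j)|].

End Numeration.

(* Main.v *)
(** Multiplying 0.w by beta^|w| turns it into an element of the spectrum, and
    every element of the spectrum arises in this way. By compactness of closed
    discs, the spectrum has no accumulation point if and only if every disc
    contains finitely many of its elements.

    If discs are finite, let K = M / (|beta| - 1), where M bounds the digits.
    Once the value of a word exceeds K + 1, its distance to K grows at least
    like |beta|^j under extension, so 0.w stays away from 0. If instead a word
    w and hence all its prefixes have values at most K + 1, and w is longer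
    than the number of spectrum elements in that disc, then two prefixes have
    the same value, and the longer one is rewritten by the shorter one padded
    with zeros.

    Conversely, given L and D, rewriting prefixes by L shortens a word without
    changing its value. A word at least as long as all left-hand sides of L
    that cannot be shortened has value larger than D |beta|^|w|, so every
    spectrum element in a given disc is the value of a word of bounded length. *)

Require Import Defs.
From HB Require Import structures.
From mathcomp Require Import all_boot all_order all_algebra finmap.
From mathcomp Require Import complex.
From mathcomp Require Import all_classical all_reals all_analysis.

Import Order.TTheory GRing.Theory Num.Theory.
Import numFieldNormedType.Exports.

Local Open Scope classical_set_scope.
Local Open Scope ring_scope.
Local Open Scope complex_scope.

(** * Discs and accumulation points in the complex plane *)

Definition disc {R : realType} (K : R) : set R[i] := [set x | `|x| <= K%:C].

Section DiscCompactness.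
Variable R : realType.

Lemma disc_Re (r x : R[i]) : r \is Num.real -> disc (complex.Re r) x = (`|x| <= r).
Proof. by move=> rr; rewrite -[in RHS](RRe_real rr). Qed.

Lemma normc_real (x : R) : `|x%:C| = `|x|%:C.
Proof. by rewrite normc_def /= expr0n addr0 sqrtr_sqr. Qed.

Lemma normc_le_ReIm (z : R[i]) :
  `|z| <= `|complex.Re z|%:C + `|complex.Im z|%:C.
Proof.
rewrite {1}[z]complexE (le_trans (ler_normD _ _))// normrM !normc_real.
by rewrite (normc_def 'i%C) /= expr0n add0r expr1n sqrtr1 mul1r.
Qed.

Lemma normc_ge_Im (z : R[i]) : `|complex.Im z|%:C <= `|z|.
Proof.
by rewrite normc_def lecR -sqrtr_sqr ler_wsqrtr// lerDr sqr_ge0.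
Qed.

Lemma complex_of_pair_continuous :
  continuous ((fun p => p.1 +i* p.2) : R * R -> R[i]^o).
Proof.
move=> p; apply/cvgrPdist_lt => e e0.
have {e0} [r r0 ->] : exists2 r : R, 0 < r & e = r%:C.
  have er : (complex.Re e)%:C = e by rewrite RRe_real// gtr0_real.
  by exists (complex.Re e) => //; rewrite -ltcR er.
have r20 : 0 < r / 2 by rewrite divr_gt0.
have c1 : (fst : R * R -> R) t @[t --> p] --> p.1 by apply: cvg_fst.
have c2 : (snd : R * R -> R) t @[t --> p] --> p.2 by apply: cvg_snd.
move/cvgrPdist_lt/(_ _ r20) : c1 => c1.
move/cvgrPdist_lt/(_ _ r20) : c2 => c2.
apply: filterS2 c1 c2 => t t1 t2.
rewrite (le_lt_trans (normc_le_ReIm _))//= -raddfD ltcR.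
by rewrite (splitr r) ltrD.
Qed.

(** The disc lies in a square, a continuous image of a product of two segments. *)
Lemma disc_sub_compact (K : R) :
  exists2 C : set R[i]^o, compact C & disc K `<=` C.
Proof.
exists [set p.1 +i* p.2 | p in `[- K, K]%classic `*` `[- K, K]%classic].
  apply: continuous_compact; last first.
    by apply: compact_setX; exact: segment_compact.
  exact/continuous_subspaceT/complex_of_pair_continuous.
move=> z zK; exists (complex.Re z, complex.Im z); last by case: z zK.
by split; rewrite /= in_itv /= -ler_norml -lecR (le_trans _ zK)//;
  [exact: normc_ge_Re|exact: normc_ge_Im].
Qed.

(* A cluster point of the filter of sets containing all but finitely many
   points of [X] is an accumulation point of [X]. *)
Lemma infinite_compact_accumulation (T : topologicalType) (C X : set T) :
  compact C -> X `<=` C -> infinite_set X -> exists s, accumulation_point X s.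
Proof.
move=> cC XC Xinf.
pose F : set_system T := [set U | finite_set (X `\` U)].
have FF : ProperFilter F.
  apply: Build_ProperFilter; first by rewrite /F /= setD0.
  split=> [|U V|U V UV]; rewrite /F /=.
  - by rewrite setDT.
  - by rewrite setDIr => fU fV; rewrite finite_setU.
  - by apply: sub_finite_set => x [Xx Vx]; split => // /UV.
have [s [_ sF]] : exists s, (C `&` cluster F) s.
  apply: cC; suff -> : F C = finite_set (set0 : set T) by [].
  by rewrite /F /=; congr finite_set; rewrite setD_eq0.
exists s => U sU finXU.
(* Since [X] meets [U] in a finite set, [X] minus [U] lies in [F], so it would have to meet [U]. *)
have [|x [+ Ux]] := sF (X `\` U) U _ sU; last by case.
by rewrite /F /= setDD.
Qed.

Lemma no_accumulation_pointP (X : set R[i]) :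
  (~ exists s : R[i]^o, accumulation_point (X : set R[i]^o) s) <->
  forall K : R, finite_set (X `&` disc K).
Proof.
split=> [noacc K|fin [s sX]].
  apply: contrapT => infX; apply: noacc.
  have [C cC KC] := disc_sub_compact K.
  have [s sXK] : exists s : R[i]^o,
      accumulation_point (X `&` disc K : set R[i]^o) s.
    by apply: infinite_compact_accumulation cC _ infX => x [_ /KC].
  exists s => U sU; apply: contra_not (sXK U sU).
  by apply: sub_finite_set => x [[]].
have /sX : nbhs s (ball s 1) by exact: nbhsx_ballx.
(* The disc of radius [|s| + 1] about 0 contains the unit ball about [s]. *)
apply; apply: sub_finite_set (fin (complex.Re (`|s : R[i]| + 1))) => x [Xx sx].
have {sx} s1 : `|(s : R[i]) - x| < 1 by move: sx; rewrite -ball_normE.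
split=> //; rewrite disc_Re ?realD ?normr_real ?real1//.
rewrite -[X in `|X| <= _](subrK (s : R[i])) addrC (le_trans (ler_normD _ _))//.
by rewrite lerD2l -normrN opprB ltW.
Qed.

End DiscCompactness.

(** * Words and their values *)

Section Words.
Variables (R : realType) (beta : R[i]).
Hypothesis beta_gt1 : 1 < `|beta|.

(* x_k ... x_0 is sent to x_k beta^k + ... + x_0. *)
Definition word_value (w : seq R[i]) : R[i] :=
  frac_value beta w * beta ^+ size w.

Let beta0 : beta != 0.
Proof. by rewrite -normr_gt0 (lt_trans ltr01). Qed.

Let normbX_gt0 n : 0 < `|beta| ^+ n.
Proof. by rewrite exprn_gt0// (lt_trans ltr01). Qed.

Lemma frac_valueE w : frac_value beta w = word_value w / beta ^+ size w.
Proof. by rewrite /word_value mulfK// expf_neq0. Qed.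

Lemma word_value_nil : word_value [::] = 0.
Proof. by rewrite /word_value /frac_value big_ord0 mul0r. Qed.

(** Horner's rule, which makes induction from the right the natural one on words. *)
Lemma word_value_rcons w a : word_value (rcons w a) = word_value w * beta + a.
Proof.
rewrite /word_value /frac_value size_rcons big_ord_recr /= nth_rcons ltnn eqxx.
rewrite mulrDl -[in RHS]mulrA -exprSr; congr (_ * _ + _); last first.
  by rewrite -mulrA mulVf ?mulr1// expf_neq0.
by apply: eq_bigr => i _; rewrite nth_rcons ltn_ord.
Qed.

Lemma word_value_cat w1 w2 q :
  word_value w1 = word_value w2 -> word_value (w1 ++ q) = word_value (w2 ++ q).
Proof.
move=> w12; elim/last_ind: q => [|q a IHq]; first by rewrite !cats0.
by rewrite -!rcons_cat !word_value_rcons IHq.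
Qed.

Lemma word_value_nseq n w : word_value (nseq n 0 ++ w) = word_value w.
Proof.
rewrite -[in RHS](cat0s w); apply: word_value_cat; elim: n => // n IHn.
rewrite -[n.+1]addn1 nseqD cats1 word_value_rcons IHn.
by rewrite word_value_nil mul0r addr0.
Qed.

Lemma word_value_rev w :
  word_value w = \sum_(k < size w) (rev w)`_k * beta ^+ k.
Proof.
elim/last_ind: w => [|w a IHw]; first by rewrite word_value_nil big_ord0.
rewrite word_value_rcons IHw size_rcons rev_rcons big_ord_recl /= mulr1 addrC.
by congr (_ + _); rewrite mulr_suml; apply: eq_bigr => i _; rewrite exprSr mulrA.
Qed.

Lemma rewriting_identityP (A : {fset R[i]}) w u :
  rewriting_identity beta A (w, u) <->
  [/\ size w = (size u).+1, {subset w <= A}, {subset u <= A} &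
      word_value w = word_value u].
Proof.
split=> -[/= wu wA uA e]; split=> //.
  have := congr1 (fun x => x * beta ^+ size w) e.
  by rewrite -/(word_value w) wu -/(word_value (0 :: u)) (word_value_nseq 1 u).
by rewrite !frac_valueE (word_value_nseq 1 u) /= wu e.
Qed.

Lemma take_subset (A : {fset R[i]}) n (w : seq R[i]) :
  {subset w <= A} -> {subset take n w <= A}.
Proof. by move=> wA x /mem_take /wA. Qed.

Lemma spectrumP (A : {fset R[i]}) : 0 \in A -> forall x,
  spectrum beta A x <-> exists2 w, {subset w <= A} & word_value w = x.
Proof.
move=> A0 x; split=> [[n [a [aA ->]]]|[w wA <-]].
  exists (rev (mkseq a n.+1)).
    by move=> y; rewrite mem_rev => /mapP[k + ->]; rewrite mem_iota => /aA.
  rewrite word_value_rev size_rev size_mkseq revK.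
  by apply: eq_bigr => k _; rewrite nth_mkseq.
(* Top exponent [size w] covers the empty word too; the extra coefficient is the default 0, which is
   a digit. *)
exists (size w), (nth 0 (rev w)); split=> [k _|].
  have [kw|kw] := ltnP k (size w); last by rewrite nth_default ?size_rev.
  by apply: wA; rewrite -mem_rev mem_nth ?size_rev.
by rewrite word_value_rev big_ord_recr /= nth_default ?size_rev// mul0r addr0.
Qed.

Lemma bounded_words (A : {fset R[i]}) (n : nat) : exists W : seq (seq R[i]),
  forall w, {subset w <= A} -> (size w <= n)%N -> w \in W.
Proof.
elim: n => [|n [W WP]].
  by exists [:: [::]] => w _; rewrite leqn0 size_eq0 inE.
exists ([::] :: [seq a :: w | a <- enum_fset A, w <- W]) => -[//|a w] awA wn.
rewrite inE; apply/orP; right; apply: allpairs_f.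
  by apply: awA; rewrite mem_head.
by apply: WP => // x xw; apply: awA; rewrite inE xw orbT.
Qed.

(** Supplies the constant [D] of preprocessing once only finitely many values have to be kept away
    from 0. *)
Lemma positive_lower_bound (s : seq R[i]) :
  exists2 D : R, 0 < D & {in s, forall x, x != 0 -> D%:C < `|x|}.
Proof.
elim: s => [|x s [D D0 DP]]; first by exists 1.
have [-> | x0] := eqVneq x 0.
  exists D => // y; rewrite inE => /predU1P[->|/DP//]; by rewrite eqxx.
pose e := complex.Re `|x| / 2.
have xE : (complex.Re `|x|)%:C = `|x| by rewrite RRe_real ?normr_real.
have xgt0 : 0 < complex.Re `|x| by rewrite -ltcR xE normr_gt0.
exists (Num.min D e) => [|y]; first by rewrite lt_min D0 divr_gt0.
rewrite inE => /predU1P[-> _|/DP yD /yD].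
  by rewrite -xE ltcR gt_min ltr_pdivrMr// mulr2n mulrDr mulr1 ltrDl xgt0 orbT.
by apply: le_lt_trans; rewrite lecR ge_min lexx.
Qed.

Lemma expr_unbounded (b x : R) : 1 < b -> exists n, x < b ^+ n.
Proof.
move=> b1; exists (Num.bound `|x / (b - 1)|).
have b10 : 0 < b - 1 by rewrite subr_gt0.
(* Bernoulli's inequality without its summand 1. *)
have bern n : (b - 1) *+ n <= b ^+ n.
  elim: n => [|n IHn]; first by rewrite expr0 ler01.
  have -> : b ^+ n.+1 = b ^+ n * (b - 1) + b ^+ n.
    by rewrite exprSr mulrBr mulr1 subrK.
  by rewrite mulrS lerD// ler_peMl ?exprn_ege1// ltW.
apply: lt_le_trans (bern _); rewrite -mulr_natl -ltr_pdivrMr//.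
by rewrite (le_lt_trans (ler_norm _))// archi_boundP.
Qed.

End Words.

(** * The two implications *)

Section Preprocessing.
Variables (R : realType) (beta : R[i]) (A : {fset R[i]}).
Hypotheses (beta_gt1 : 1 < `|beta|) (A0 : 0 \in A).

Local Notation V := (word_value R beta).
Local Notation M := (\sum_(a <- enum_fset A) `|a|).
Local Notation K := (M / (`|beta| - 1)).

Let normb_gt0 : 0 < `|beta|.
Proof. exact: lt_trans ltr01 _. Qed.

Let digit_bound a : a \in A -> `|a| <= M.
Proof.
by move=> aA; rewrite (big_rem a)//= lerDl sumr_ge0.
Qed.

Let K_ge0 : 0 <= K.
Proof. by rewrite divr_ge0 ?sumr_ge0// subr_ge0 ltW. Qed.

(* K is the fixed point of x |-> (x + M) / |beta|, so the distance to K is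
   expanded by |beta| at least at each step. *)
Let K_fix : K * `|beta| = K + M.
Proof.
have b10 : `|beta| - 1 != 0 by rewrite gt_eqF// subr_gt0.
have distr (x y z : R[i]) : y * (x - 1) = z -> y * x = y + z.
  by move=> <-; rewrite mulrBr mulr1 addrC subrK.
by apply: distr; rewrite divfK.
Qed.

Let word_value_rcons_ge w a : a \in A ->
  (`|V w| - K) * `|beta| <= `|V (rcons w a)| - K.
Proof.
move=> aA; rewrite word_value_rcons// mulrBl K_fix -normrM opprD addrA.
rewrite lerBlDr [in leRHS]addrAC lerD2r.
rewrite (le_trans _ (lerD (lexx _) (digit_bound a aA)))//.
by rewrite -[X in `|X| <= _](addrK a) ler_normB.
Qed.

Let word_value_growth w q : {subset q <= A} ->
  (`|V w| - K) * `|beta| ^+ size q <= `|V (w ++ q)| - K.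
Proof.
elim/last_ind: q => [|q a IHq] qA; first by rewrite cats0 mulr1.
rewrite -rcons_cat size_rcons exprSr mulrA.
apply: le_trans (word_value_rcons_ge _ _ _); last first.
  by apply: qA; rewrite mem_rcons mem_head.
rewrite ler_wpM2r// IHq// => x xq.
by apply: qA; rewrite mem_rcons inE xq orbT.
Qed.

(** A prefix whose value exceeds [K] by more than 1 would have this excess expanded by the digits
    that follow. *)
Let word_value_take_le w j : {subset w <= A} ->
  `|V w| <= K + 1 -> `|V (take j w)| <= K + 1.
Proof.
move=> wA; rewrite -!lerBlDl => Vw1.
have := word_value_growth (take j w) (drop j w).
rewrite cat_take_drop => /(_ (fun x xw => wA x (mem_drop xw))) /le_trans /(_ Vw1).
rewrite -ler_pdivlMr ?exprn_gt0// => /le_trans; apply.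
by rewrite mul1r invf_le1 ?exprn_gt0// exprn_ege1// ltW.
Qed.

(* Pigeonhole: among the prefixes of a long word of small value, two have the
   same value, and the longer one is then rewritten by the shorter one. *)
Lemma long_word_reducible :
  (forall r : R, finite_set (spectrum beta A `&` disc r)) ->
  exists n, forall w, {subset w <= A} -> size w = n -> `|V w| <= K + 1 ->
    exists j u, rewriting_identity beta A (take j w, u).
Proof.
move=> /(_ (complex.Re (K + 1))) /finite_seqP[s sP].
exists (size s) => w wA ws Vw.
have prefs i : V (take i w) \in s.
  suff : [set` s] (V (take i w)) by [].
  rewrite -sP; split.
    apply/(spectrumP R beta beta_gt1 A A0).
    by exists (take i w) => //; exact: take_subset.
  rewrite disc_Re ?ger0_real ?addr_ge0//.
  exact: word_value_take_le.
have : ~~ uniq (mkseq (fun i => V (take i w)) (size s).+1).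
  apply/negP => /uniq_leq_size => /(_ s); rewrite size_mkseq ltnn.
  by move=> H; suff : false by []; apply: H => x /mapP[i _ ->].
case/(uniqPn 0) => i [j [ij]]; rewrite size_mkseq => js.
rewrite !nth_mkseq ?(ltn_trans ij)// => Vij.
(* Leading zeros keep the value and bring the shorter prefix to length [j - 1], as an identity
   requires. *)
exists j, (nseq (j - i).-1 0 ++ take i w).
apply/rewriting_identityP => //; split => //.
- rewrite size_cat size_nseq !size_takel ?ws//; last first.
    by rewrite -ltnS (ltn_trans ij).
  by rewrite -addSn prednK ?subn_gt0// subnK// ltnW.
- exact: take_subset.
- move=> x; rewrite mem_cat => /orP[/nseqP[->]//|]; exact: take_subset.
- by rewrite word_value_nseq.
Qed.

Lemma preprocessing_of_finite :
  (forall r : R, finite_set (spectrum beta A `&` disc r)) ->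
  allows_preprocessing beta A.
Proof.
move=> /long_word_reducible [n nP].
have [W WP] := bounded_words R A n.
(* The values of words in [W] serve prefixes of length at most [n]; the bound [|beta| ^- n] serves
   the longer ones. *)
have [D D0 DP] :=
  positive_lower_bound R ((`|beta| ^- n) :: map (frac_value beta) W).
pose L := [seq p <- [seq (w, u) | w <- W, u <- W]
          | `[<rewriting_identity beta A p>]].
have LP w u : (size w <= n)%N -> rewriting_identity beta A (w, u) ->
    w \in unzip1 L.
  move=> wn wu; have [/= wS wA uA _] := wu.
  apply/mapP; exists (w, u) => //; rewrite mem_filter; apply/andP; split.
    exact/asboolP.
  apply: allpairs_f; apply: WP => //.
  by rewrite ltnW// -wS.
exists D, L; split=> //.
  by move=> p; rewrite mem_filter => /andP[/asboolP].
move=> d dA dL j j1.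
have mkA m : {subset mkseq d m <= A} by move=> x /mapP[i _ ->].
have [jn|nj] := leqP j n.
  apply: DP; first by rewrite inE map_f ?orbT// WP ?size_mkseq.
  (* A prefix of value 0 could be rewritten by zeros, hence would occur in [L]. *)
  apply/eqP => fj0; have := dL j; apply/negP; rewrite negbK.
  apply: (LP _ (nseq j.-1 0)); first by rewrite size_mkseq.
  apply/rewriting_identityP => //; split => //.
  - by rewrite size_mkseq size_nseq prednK.
  - by move=> x /nseqP[->].
  - rewrite -[nseq _ _]cats0 word_value_nseq// word_value_nil.
    by rewrite /word_value fj0 mul0r.
have Vn : K + 1 < `|V (mkseq d n)|.
  rewrite real_ltNge ?ger0_real ?addr_ge0//.
  apply/negP => /(nP _ (mkA n) (size_mkseq _ _)) [k [u ku]].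
  have kd : take k (mkseq d n) = mkseq d (minn k n).
    by rewrite /mkseq -map_take take_iota.
  have := dL (minn k n); rewrite -kd (LP _ u)//.
  by rewrite kd size_mkseq geq_minr.
have dE : mkseq d j = mkseq d n ++ map d (iota n (j - n)).
  by rewrite /mkseq -map_cat -{2}[n]add0n -iotaD subnKC// ltnW.
(* The excess over [K] is above 1 at length [n] and grows by [|beta| ^+ (j - n)]; division by
   [|beta| ^+ j] leaves [|beta| ^- n]. *)
apply: lt_le_trans (DP (`|beta| ^- n) _ _) _.
- by rewrite mem_head.
- by rewrite invr_eq0 expf_neq0// gt_eqF.
rewrite ger0_norm ?invr_ge0 ?exprn_ge0// frac_valueE// size_mkseq.
rewrite normrM normfV normrX ler_pdivlMr ?exprn_gt0//.
rewrite -{1}(subnKC (ltnW nj)) exprD mulKf ?expf_neq0 ?gt_eqF//.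
have tailA : {subset map d (iota n (j - n)) <= A} by move=> x /mapP[i _ ->].
have le_sub : `|V (mkseq d j)| - K <= `|V (mkseq d j)| by rewrite gerBl.
apply: le_trans le_sub; rewrite dE.
apply: le_trans (word_value_growth (mkseq d n) _ tailA).
by rewrite size_map size_iota ler_peMl ?exprn_ge0// lerBrDl ltW.
Qed.

Lemma finite_of_preprocessing :
  allows_preprocessing beta A ->
  forall r : R, finite_set (spectrum beta A `&` disc r).
Proof.
move=> [D [L [D0 LA LD]]] r.
have bE : (complex.Re `|beta|)%:C = `|beta| by rewrite RRe_real ?normr_real.
have [N rN] : exists N, r / D < complex.Re `|beta| ^+ N.
  by apply: expr_unbounded; rewrite -ltcR bE.
(* Beyond length [N] irreducible words have value above [r]; the second bound makes every left-hand
   side fit into a longer word. *)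
pose n := maxn N (\max_(p <- L) size p.1).
have [W WP] := bounded_words R A n.
have short k w : (size w <= k)%N -> {subset w <= A} -> `|V w| <= r%:C ->
    exists2 w', w' \in W & V w' = V w.
  elim: k w => [|k IHk] w wk wA Vw.
    by exists w => //; apply: WP => //; apply: leq_trans wk _.
  have [wn|nw] := leqP (size w) n; first by exists w => //; apply: WP.
  (* The default digit 0 continues [w] to an infinite string, as [LD] requires. *)
  pose d i := nth 0 w i.
  have mkd m : (m <= size w)%N -> mkseq d m = take m w.
    move=> mw; rewrite -[in RHS](mkseq_nth 0 w) /mkseq -map_take take_iota.
    by rewrite (minn_idPl mw).
  have [noL|] := pselect (forall m, mkseq d m \notin unzip1 L).
    have dA i : d i \in A.
      rewrite /d; have [iw|iw] := ltnP i (size w); last by rewrite nth_default.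
      exact/wA/mem_nth.
    have := LD d dA noL (size w) (leq_ltn_trans (leq0n _) nw).
    rewrite mkd// take_size frac_valueE// normrM normfV normrX.
    rewrite ltr_pdivlMr ?exprn_gt0// => /lt_le_trans/(_ Vw).
    rewrite -bE -rmorphXn -rmorphM ltcR mulrC -ltr_pdivlMr// => /ltW.
    rewrite leNgt => /negP; case; apply: lt_le_trans rN _.
    rewrite ler_eXn2l -?ltcR ?bE//.
    exact: leq_trans (leq_maxl _ _) (ltnW nw).
  (* Otherwise a prefix of [w] is a left-hand side, and replacing it removes one digit. *)
  move=> /existsNP[m /negP]; rewrite negbK => /mapP[[v u] vuL /= vE].
  have mn : (m <= n)%N.
    rewrite -(size_mkseq d m) vE; apply: leq_trans (leq_maxr _ _).
    exact: (@leq_bigmax_seq _ L xpredT (fun p => size p.1) (v, u) vuL isT).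
  have mw : (m <= size w)%N by rewrite (leq_trans mn)// ltnW.
  have /rewriting_identityP[//|vS vA uA Vvu] := LA _ vuL.
  have wE : V (u ++ drop m w) = V w.
    rewrite -[in RHS](cat_take_drop m w); apply: word_value_cat => //.
    by rewrite -mkd// vE.
  have mS : m = (size u).+1 by rewrite -vS -vE size_mkseq.
  have uS : (size (u ++ drop m w) <= k)%N.
    by rewrite size_cat size_drop -ltnS -addSn -mS subnKC.
  have uwA : {subset u ++ drop m w <= A}.
    by move=> x; rewrite mem_cat => /orP[/uA//|/mem_drop/wA].
  by rewrite -wE; apply: IHk; rewrite ?wE.
apply: sub_finite_set (finite_seq (map V W)) => x [].
move=> /(spectrumP R beta beta_gt1 A A0)[w wA <-] Vw.
by have [w' w'W <-] := short _ w (leqnn _) wA Vw; apply: map_f.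
Qed.

End Preprocessing.

(* [R[i]^o] is the complex field equipped with the topology of its norm. *)
Theorem theorem5p4 (R : realType) (beta : R[i]) (A : {fset R[i]})
    (hbeta : 1 < `|beta|) (hA : 0 \in A) :
  allows_preprocessing beta A <->
  ~ exists s : R[i]^o, accumulation_point (spectrum beta A : set R[i]^o) s.
Proof.
split=> [pre|noacc].
  exact/no_accumulation_pointP/(finite_of_preprocessing R beta A hbeta hA).
apply: preprocessing_of_finite => //.
exact/no_accumulation_pointP.
Qed.
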